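(* There are universal constants $c>0$ and $T_0$ such that for every $T \ge T_0$ there is a (randomized, adaptive) adversary strategy for the $T$-step sequential binary prediction game such that every forecasting algorithm incurs $\mathbb{E}[\mathsf{CalDist}(x,p)] \ge c\,T^{1/3}$, where $x$ is the sequence of outcomes and $p$ the sequence of predictions.
   Context: Sequential binary prediction game with horizon $T$: at each step $t \in [T]$, the adversary picks a bit $x_t \in \{0,1\}$ and simultaneously the forecaster picks a prediction $p_t \in [0,1]$; both may depend on all previous outcomes and predictions (and on their own randomness); then $x_t,p_t$ are revealed to both. For $x \in \{0,1\}^T$, let $\mathcal{C}(x) = \{q \in [0,1]^T : \sum_{t=1}^T (x_t - q_t)\mathbf{1}[q_t = \alpha] = 0 \text{ for all } \alpha \in [0,1]\}$, and $\mathsf{CalDist}(x,p) = \min_{q \in \mathcal{C}(x)} \|p - q\|_1$. The expectation is over the randomness of both players. *)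

(* Defs.v *)
From HB Require Import structures.
From mathcomp Require Import all_boot all_order all_algebra.
From mathcomp Require Import all_classical all_reals all_analysis.
Set Implicit Arguments. Unset Strict Implicit. Unset Printing Implicit Defensive.
Import Order.TTheory GRing.Theory Num.Theory.
Import numFieldNormedType.Exports.
Local Open Scope classical_set_scope.
Local Open Scope ring_scope.

Section CalDist.
Variables (R : realType) (T : nat).

Definition calibrated (x : 'I_T -> bool) (q : 'I_T -> R) : Prop :=
  (forall t, 0 <= q t <= 1) /\
  forall alpha : R, \sum_(t < T) ((x t)%:R - q t) * (q t == alpha)%:R = 0.

Definition l1dist (p q : 'I_T -> R) : R := \sum_(t < T) `|p t - q t|.

(** CalDist(x,p) = min_{q in C(x)} ||p - q||_1 (written as an infimum; the
    set C(x) is finite and nonempty, so the infimum is the minimum). *)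
Definition CalDist (x : 'I_T -> bool) (p : 'I_T -> R) : R :=
  inf [set l1dist p q | q in [set q | calibrated x q]].

Definition prefix (A : Type) (x : 'I_T -> A) (t : nat) : seq A :=
  map x [seq i <- enum 'I_T | (nat_of_ord i < t)%N].

(** A (seeded) forecaster: given its random seed w and the past outcomes,
    it outputs the next prediction; its past predictions are determined by
    these, so this is fully general. *)
Definition predictions (Omega : Type) (F : Omega -> seq bool -> R)
  (w : Omega) (x : 'I_T -> bool) : 'I_T -> R :=
  fun t => F w (prefix x t).

(** Behavioral adversary: adv xs ps = probability that the next outcome is 1,
    given the past outcomes xs and past predictions ps. Probability of the
    outcome vector x when the forecaster uses seed w. *)
Definition outcome_prob (Omega : Type) (adv : seq bool -> seq R -> R)
  (F : Omega -> seq bool -> R) (w : Omega) (x : 'I_T -> bool) : R :=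
  \prod_(t < T)
    (let a := adv (prefix x t) (prefix (predictions F w x) t) in
     if x t then a else 1 - a).

Definition cond_exp_caldist (Omega : Type) (adv : seq bool -> seq R -> R)
  (F : Omega -> seq bool -> R) (w : Omega) : R :=
  \sum_(x : {ffun 'I_T -> bool})
     outcome_prob adv F w x * CalDist x (predictions F w x).

End CalDist.

(* Main.v *)
(* Testing a calibrated q against the functions 1 and 1/2 - r shows that
   CalDist is at least |U| and at least Z / 2, where U = sum (x_t - p_t) and
   Z = sum (1/2 - p_t) (x_t - p_t). The adversary tosses fair coins until U
   or Z leaves the range |U| < D, Z < D, with D = T^(1/3). If U leaves, the
   adversary outputs the same bit forever, so that |U| never decreases; if Z
   leaves, it keeps tossing fair coins, so that Z is a submartingale. While
   nothing has happened, U^2 grows by 1/4 per round on average unless the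
   forecaster corrects it with a drift d = 1/2 - p, and the drift costs d^2 in
   Z. Hence Z / 4 + U^2 / (32 D^2) + n / (256 D^2) - 1/32, with n the number of
   remaining rounds, continued by |U| or Z / 2 once the range is left, is a
   submartingale whose final value is at most CalDist and whose initial value
   is of order D. *)
Require Import Defs.
From HB Require Import structures.
From mathcomp Require Import all_boot all_order all_algebra.
From mathcomp Require Import all_classical all_reals all_analysis.
From mathcomp Require Import ring lra.
Import Order.TTheory GRing.Theory Num.Theory.
Local Open Scope classical_set_scope.
Local Open Scope ring_scope.

(** * Lower bounds on [CalDist] by test functions *)

Section CalDistLowerBounds.
Variables (R : realType) (T : nat).
Implicit Types (x : 'I_T -> bool) (p q : 'I_T -> R).

(** Grouping the rounds by the value of [q] gives a combination of calibration equations. *)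
Lemma calibrated_sum0 x q (g : R -> R) : calibrated x q ->
  \sum_(t < T) g (q t) * ((x t)%:R - q t) = 0.
Proof.
case=> _ cal; pose vals := undup [seq q t | t <- enum 'I_T].
transitivity (\sum_(al <- vals)
    g al * \sum_(t < T) ((x t)%:R - q t) * (q t == al)%:R).
  under [RHS]eq_bigr do rewrite mulr_sumr.
  rewrite exchange_big /=; apply: eq_bigr => t _.
  rewrite (bigD1_seq (q t)) ?undup_uniq//=; last first.
    by rewrite mem_undup map_f ?mem_enum.
  rewrite eqxx mulr1 big1 ?addr0// => al /negPf al_ne.
  by rewrite [q t == _]eq_sym al_ne mulr0 mulr0.
by rewrite big1 // => al _; rewrite cal mulr0.
Qed.

(** Provides nonemptiness, so that [inf] in [CalDist] is not a default value. *)
Lemma calibrated_self x : calibrated x (fun t => (x t)%:R : R).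
Proof.
split=> [t|al]; first by case: (x t); rewrite ?lexx ?ler01.
by rewrite big1 // => t _; rewrite subrr mul0r.
Qed.

Lemma CalDist_ge x p (m : R) :
  (forall q, calibrated x q -> m <= l1dist p q) -> m <= CalDist x p.
Proof.
move=> mle; apply: lb_le_inf; last by move=> _ [q calq <-]; exact: mle.
by exists (l1dist p (fun t => (x t)%:R)), (fun t => (x t)%:R) => //;
  exact: calibrated_self.
Qed.

(* A calibrated q annihilates every test function g, so a Lipschitz bound on
   g(r) (x_t - r) converts the g-weighted bias of p into a distance. *)
Lemma CalDist_ge_test x p (g : R -> R) (L : R) : 0 < L ->
  (forall t r, 0 <= r <= 1 ->
     g (p t) * ((x t)%:R - p t) - g r * ((x t)%:R - r) <= L * `|p t - r|) ->
  (\sum_(t < T) g (p t) * ((x t)%:R - p t)) / L <= CalDist x p.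
Proof.
move=> L0 lip; apply: CalDist_ge => q calq.
rewrite ler_pdivrMr// mulrC -[leLHS]subr0 -[X in _ - X](calibrated_sum0 _ _ g calq).
rewrite -sumrB mulr_sumr; apply: ler_sum => t _.
by apply: lip; case: calq.
Qed.

Lemma CalDist_ge_bias x p : \sum_(t < T) ((x t)%:R - p t) <= CalDist x p.
Proof.
have := @CalDist_ge_test x p (fun=> 1) 1 ltr01; rewrite divr1.
under eq_bigr do rewrite mul1r.
apply=> t q _; rewrite !mul1r distrC.
by apply: le_trans (ler_norm _); lra.
Qed.

Lemma CalDist_ge_biasN x p : - (\sum_(t < T) ((x t)%:R - p t)) <= CalDist x p.
Proof.
have := @CalDist_ge_test x p (fun=> -1) 1 ltr01; rewrite divr1 -sumrN.
under eq_bigr do rewrite mulN1r.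
apply=> t q _; rewrite !mulN1r mul1r.
by apply: le_trans (ler_norm _); lra.
Qed.

Lemma CalDist_ge_linear x p : (forall t, 0 <= p t <= 1) ->
  (\sum_(t < T) (2^-1 - p t) * ((x t)%:R - p t)) / 2 <= CalDist x p.
Proof.
move=> p01; apply: (@CalDist_ge_test x p (fun r => 2^-1 - r)) => // t q q01.
have {p01} := p01 t; move: (p t) => r r01.
have -> : (2^-1 - r) * ((x t)%:R - r) - (2^-1 - q) * ((x t)%:R - q) =
    (r - q) * (r + q - 2^-1 - (x t)%:R) by field.
(* The second factor lies in [-3/2, 3/2], so the constant 2 suffices. *)
apply: le_trans (ler_norm _) _; rewrite normrM mulrC ler_wpM2r//.
by rewrite ler_norml; case: (x t) => /=; lra.
Qed.

End CalDistLowerBounds.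

(** * Submartingales on the tree of outcome sequences *)

Section SeqOutcomes.
Variables (R : realType) (T : nat).
Implicit Types xs : seq bool.

Lemma prefix_take (A : Type) (x : 'I_T -> A) t : (t <= T)%N ->
  Defs.prefix x t = take t [seq x i | i <- enum 'I_T].
Proof.
move=> leT; rewrite /Defs.prefix -map_take; congr map.
apply: (inj_map val_inj); rewrite map_take val_enum_ord take_iota.
rewrite (eq_filter (a2 := preim val (fun i => i < t)%N))// -filter_map.
by rewrite val_enum_ord (@filter_iota_ltn 0)// (minn_idPl leT).
Qed.

Definition branch (a : R) (b : bool) : R := if b then a else 1 - a.

(** Induction on the number of bits to come, for all [xs]: the first of them is split off and
    appended to [xs]. *)
Lemma ler_branch_tuple_sum (a W : seq bool -> R) :
  (forall xs, 0 <= a xs <= 1) ->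
  (forall xs, (size xs < T)%N ->
    W xs <= a xs * W (rcons xs true) + (1 - a xs) * W (rcons xs false)) ->
  forall n xs, (size xs + n = T)%N ->
    W xs <= \sum_(s : n.-tuple bool)
      (\prod_(i < n) branch (a (xs ++ take i s)) (nth false s i)) * W (xs ++ s).
Proof.
move=> a01 Wle; elim=> [|n IH] xs szT.
  rewrite (big_pred1 [tuple])/=; last by move=> s; apply/esym/eqP; exact: tuple0.
  by rewrite big_ord0 mul1r cats0.
have xsT : (size xs < T)%N by rewrite -szT addnS ltnS leq_addr.
pose h (bs : bool * n.-tuple bool) := [tuple of bs.1 :: bs.2].
rewrite (reindex h) /=; last first.
  exists (fun s => (thead s, [tuple of behead s])) => [[b s] _|s _] /=.
    by congr pair; apply: val_inj.
  by rewrite /h [RHS]tuple_eta.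
rewrite -(pair_bigA _ (fun (b : bool) (s : n.-tuple bool) => (\prod_(i < n.+1)
    branch (a (xs ++ take i (b :: s))) (nth false (b :: s) i)) *
    W (xs ++ b :: s))) /=.
rewrite big_bool /=.
have step b : branch (a xs) b * W (rcons xs b) <=
    \sum_(s : n.-tuple bool) (\prod_(i < n.+1)
    branch (a (xs ++ take i (b :: s))) (nth false (b :: s) i)) *
    W (xs ++ b :: s).
  under eq_bigr do rewrite big_ord_recl /= cats0 -mulrA -cat_rcons.
  rewrite -mulr_sumr; apply: ler_wpM2l.
    by rewrite /branch; case: b; have := a01 xs; lra.
  under eq_bigr do under eq_bigr do rewrite add0n -cat_rcons.
  by apply: IH; rewrite size_rcons addSn -addnS.
apply: le_trans (Wle _ xsT) _.
exact: lerD (step true) (step false).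
Qed.

Lemma sum_ffun_tuple (G : seq bool -> R) :
  \sum_(x : {ffun 'I_T -> bool}) G [seq x i | i <- enum 'I_T] =
  \sum_(s : T.-tuple bool) G s.
Proof.
rewrite (reindex (fun s : T.-tuple bool => [ffun i => tnth s i])) /=.
  apply: eq_bigr => s _; congr G.
  rewrite -[RHS](map_tnth_enum s); apply: eq_map => i.
  by rewrite ffunE.
exists (fun x : {ffun 'I_T -> bool} => [tuple x i | i < T]) => [s _|x _].
  by apply: eq_from_tnth => i; rewrite tnth_mktuple ffunE.
by apply/ffunP => i; rewrite ffunE tnth_mktuple.
Qed.

(** Once the seed is fixed, the whole history is a function of the bits. *)
Definition past_predictions (f : seq bool -> R) xs : seq R :=
  mkseq (fun i => f (take i xs)) (size xs).

Lemma past_predictions_rcons f xs b :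
  past_predictions f (rcons xs b) = rcons (past_predictions f xs) (f xs).
Proof.
rewrite /past_predictions size_rcons mkseqS -(cats1 xs) take_size_cat//.
congr rcons; apply/eq_in_map => i; rewrite mem_iota add0n => /andP[_ ltis].
by rewrite take_cat ltis.
Qed.

Lemma prefix_predictions Omega (F : Omega -> seq bool -> R) w
    (x : 'I_T -> bool) t : (t <= T)%N ->
  Defs.prefix (predictions F w x) t = past_predictions (F w) (Defs.prefix x t).
Proof.
move=> tT; rewrite !prefix_take//.
have szE (A : Type) (y : 'I_T -> A) : size [seq y i | i <- enum 'I_T] = T.
  by rewrite size_map size_enum_ord.
apply: (@eq_from_nth _ 0); first by rewrite size_mkseq !size_take !szE.
rewrite size_takel ?szE// => i it; have iT := leq_trans it tT.
rewrite nth_take// (nth_map (Ordinal iT)) ?size_enum_ord// nth_mkseq; last first.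
  by rewrite size_takel ?szE.
by rewrite take_takel ?(ltnW it)// /predictions nth_enum_ord// prefix_take// ltnW.
Qed.

End SeqOutcomes.

(** * The adversary and its potential *)

Section Adversary.
Variables (R : realType) (D : R).

(* The mode [Fair] protects against a forecaster that would make [corr] large
   and then cause a lock, after which [corr] is out of the adversary's control:
   under fair coins [corr] keeps its expectation or gains. *)
Inductive mode := Active | Fair | Lock of bool.

(* [bias] is the sum of x_t - p_t and [corr] that of (1/2 - p_t) (x_t - p_t). *)
Record state := State { phase : mode; bias : R; corr : R }.

Definition leave_active (U Z : R) : mode :=
  if D <= U then Lock true else if U <= - D then Lock false
  else if D <= Z then Fair else Active.

Definition update (st : state) (xp : bool * R) : state :=
  let: State m U Z := st in
  let U' := U + (xp.1%:R - xp.2) in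
  let Z' := Z + (2^-1 - xp.2) * (xp.1%:R - xp.2) in
  State (if m is Active then leave_active U' Z' else m) U' Z'.

Definition run (xs : seq bool) (ps : seq R) : state :=
  foldl update (State Active 0 0) (zip xs ps).

Definition adversary (xs : seq bool) (ps : seq R) : R :=
  match phase (run xs ps) with Lock b => b%:R | _ => 2^-1 end.

Lemma adversary_01 xs ps : 0 <= adversary xs ps <= 1.
Proof. by rewrite /adversary; case: phase => [||[]] /=; lra. Qed.

Lemma foldl_update_bias_corr (l : seq (bool * R)) (st : state) :
  bias (foldl update st l) = bias st + \sum_(xp <- l) (xp.1%:R - xp.2) /\
  corr (foldl update st l) =
    corr st + \sum_(xp <- l) (2^-1 - xp.2) * (xp.1%:R - xp.2).
Proof.
elim: l st => [|xp l IH] st /=; first by rewrite !big_nil !addr0.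
by have [-> ->] := IH (update st xp); rewrite !big_cons; case: st => m U Z /=;
  rewrite !addrA.
Qed.

Definition active_bounded (st : state) : Prop :=
  if st is State Active U Z then [/\ - D <= U, U <= D & Z <= D] else True.

Lemma active_bounded_update st xp :
  active_bounded st -> active_bounded (update st xp).
Proof.
case: st => [[||b] U Z] //= _; rewrite /leave_active.
move: (U + _) (Z + _) => U' Z'.
have [//|/ltW ?] := leP D U'; have [//|/ltW ?] := leP U' (- D).
by have [//|/ltW ?] := leP D Z'.
Qed.

Lemma active_bounded_run xs ps : 0 <= D -> active_bounded (run xs ps).
Proof.
move=> D0; rewrite /run; have: active_bounded (State Active 0 0) by split; lra.
by elim: zip (State Active 0 0) => //= xp l IH st /(active_bounded_update _ xp)/IH.
Qed.

Definition active_potential (n : nat) (U Z : R) : R :=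
  Z / 4 + (U / D) ^+ 2 / 32 + n%:R / D ^+ 2 / 256 - 32^-1.

(* Lower bound on the expected final CalDist with [n] rounds to go. *)
Definition potential (n : nat) (st : state) : R :=
  match st with
  | State Active U Z => active_potential n U Z
  | State Fair _ Z => Z / 2
  | State (Lock b) U _ => if b then U else - U
  end.

(** One round overshoots the range by at most 1 in [U] and 1/2 in [Z]. The square and round terms
    are then at most 1/8 and [D / 256], less than the gap between [Z / 4] and the new value, which
    is at least [D] or equal to [Z / 2]. *)
Lemma active_potential_le_leave n (U Z : R) : 16 <= D -> n%:R <= D ^+ 3 ->
  `|U| <= D + 1 -> Z <= D + 2^-1 ->
  active_potential n U Z <= potential n (State (leave_active U Z) U Z).
Proof.
move=> D16 nD; rewrite ler_norml => SD ZD; have D0 : 0 < D by lra.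
have nD2 : n%:R / D ^+ 2 <= D.
  by rewrite ler_pdivrMr ?exprn_gt0// -exprS.
have SD2 : (U / D) ^+ 2 <= 4.
  have : -2 <= U / D <= 2.
    by rewrite ler_pdivrMr// ler_pdivlMr//; lra.
  by move: (U / D) => u u2; nra.
rewrite /leave_active.
have [DS|_] := leP D U; first by rewrite /= /active_potential; lra.
have [DS|_] := leP U (- D); first by rewrite /= /active_potential; lra.
have [DZ|_] := leP D Z; first by rewrite /= /active_potential; lra.
by [].
Qed.

(** With d = 1/2 - p, the mean gain of [Z] is d^2 and that of [U ^+ 2] is 2 U d + d^2 + 1/4. Half of
    the 1/4 pays for the elapsed round, the other half for completing the square, as |U| <= D. *)
Lemma active_potential_mean n (U Z p : R) : 0 < D -> - D <= U <= D ->
  active_potential n.+1 U Z <=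
    2^-1 * active_potential n (U + (1 - p)) (Z + (2^-1 - p) * (1 - p)) +
    2^-1 * active_potential n (U + (0 - p)) (Z + (2^-1 - p) * (0 - p)).
Proof.
move=> D0 SD; rewrite /active_potential -natr1 -subr_ge0.
set d := 2^-1 - p; set e := D^-1; set s := U / D.
have s1 : - 1 <= s <= 1.
  by rewrite /s ler_pdivrMr// ler_pdivlMr//; lra.
(* The gain d^2 of [corr] pays for the cross term 2 U d of the square. *)
have : 0 <= (8 * d + e * s) ^+ 2 / 256 + e ^+ 2 * (1 - s ^+ 2) / 256 + e ^+ 2 * d ^+ 2 / 32.
  have s2 : 0 <= 1 - s ^+ 2 by nra.
  have := mulr_ge0 (sqr_ge0 e) s2; have := mulr_ge0 (sqr_ge0 e) (sqr_ge0 d).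
  by have := sqr_ge0 (8 * d + e * s); lra.
congr (0 <= _); rewrite /d /e /s; field.
by rewrite gt_eqF.
Qed.

Lemma potential_step n xs ps (p : R) : 16 <= D -> 0 <= p <= 1 -> n%:R <= D ^+ 3 ->
  potential n.+1 (run xs ps) <=
    adversary xs ps * potential n (update (run xs ps) (true, p)) +
    (1 - adversary xs ps) * potential n (update (run xs ps) (false, p)).
Proof.
move=> D16 p01 nD; have D0 : 0 < D by lra.
have := active_bounded_run xs ps (ltW D0); rewrite /adversary.
case: (run xs ps) => [[||[]] U Z] /=; last 3 first.
(* In [Fair] the mean gain of [corr] is a square; in [Lock] the forced bit pushes [bias] outward by
   [1 - p] or [p]. *)
- by move=> _; have := sqr_ge0 (2^-1 - p); lra.
- by move=> _; lra.
- by move=> _; lra.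
move=> [S_ge S_le Z_le]; have S_bnd : - D <= U <= D by rewrite S_ge.
apply: le_trans (active_potential_mean n _ Z p D0 S_bnd) _.
have -> : 1 - 2^-1 = 2^-1 :> R by lra.
have Sn (b : bool) : `|U + (b%:R - p)| <= D + 1.
  by rewrite ler_norml; case: b => /=; lra.
have Zn (b : bool) : Z + (2^-1 - p) * (b%:R - p) <= D + 2^-1.
  by case: b => /=; nra.
rewrite lerD// ler_wpM2l//.
  exact: active_potential_le_leave D16 nD (Sn true) (Zn true).
exact: active_potential_le_leave D16 nD (Sn false) (Zn false).
Qed.

(** In [Active], -1/32 absorbs the square term and leaves [Z / 4]; the two bounds on [bias] force m
    >= 0, so [Z / 2 <= m] is enough. *)
Lemma potential0_le st (m : R) : 0 < D -> active_bounded st ->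
  bias st <= m -> - bias st <= m -> corr st / 2 <= m -> potential 0 st <= m.
Proof.
move=> D0; case: st => [[||[]] U Z] //= [S_ge S_le Z_le] Sm SNm Zm.
rewrite /active_potential !mul0r.
have s1 : - 1 <= U / D <= 1.
  by rewrite ler_pdivrMr// ler_pdivlMr//; lra.
by have : (U / D) ^+ 2 <= 1; [nra | lra].
Qed.

Lemma cond_exp_caldist_ge (T : nat) Omega (F : Omega -> seq bool -> R) w :
  16 <= D -> (forall xs, 0 <= F w xs <= 1) -> T%:R <= D ^+ 3 ->
  potential T (State Active 0 0) <= cond_exp_caldist T adversary F w.
Proof.
move=> D16 F01 TD; have D0 : 0 < D by lra.
pose st xs := run xs (past_predictions R (F w) xs).
pose a xs := adversary xs (past_predictions R (F w) xs).
(* The submartingale along the play against the forecaster with seed [w]. *)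
pose W xs := potential (T - size xs) (st xs).
have st_rcons xs b : st (rcons xs b) = update (st xs) (b, F w xs).
  rewrite /st past_predictions_rcons /run zip_rcons ?size_mkseq//.
  by rewrite foldl_rcons.
have Wstep xs : (size xs < T)%N ->
    W xs <= a xs * W (rcons xs true) + (1 - a xs) * W (rcons xs false).
  move=> xsT; rewrite /W !st_rcons !size_rcons -(subnSK xsT).
  apply: potential_step => //.
  by apply: le_trans TD; rewrite ler_nat leq_subr.
have := @ler_branch_tuple_sum R T a W (fun _ => adversary_01 _ _) Wstep T [::]
  (add0n T).
rewrite {1}/W subn0 => /le_trans; apply.
rewrite -(sum_ffun_tuple _ _ (fun s => (\prod_(i < T)
  branch R (a (take i s)) (nth false s i)) * W s)).
apply: ler_sum => x _; set s := [seq x i | i <- enum 'I_T].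
have szs : size s = T by rewrite size_map size_enum_ord.
have nth_s (t : 'I_T) : nth false s t = x t.
  by rewrite (nth_map t) ?size_enum_ord// nth_ord_enum.
have pre (t : 'I_T) : Defs.prefix x t = take t s.
  by rewrite prefix_take// ltnW.
have -> : outcome_prob adversary F w x =
    \prod_(i < T) branch R (a (take i s)) (nth false s i).
  apply: eq_bigr => t _; rewrite nth_s /branch /a -pre.
  by rewrite prefix_predictions// ltnW.
apply: ler_wpM2l.
  apply: prodr_ge0 => t _; rewrite /branch /a.
  by have := adversary_01 (take t s) (past_predictions R (F w) (take t s));
    case: nth; lra.
have sum_zip (g : bool -> R -> R) :
    \sum_(xp <- zip s (past_predictions R (F w) s)) g xp.1 xp.2 =
    \sum_(t < T) g (x t) (predictions F w x t).
  have -> : past_predictions R (F w) s =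
      [seq predictions F w x t | t <- enum 'I_T].
    apply: (@eq_from_nth _ 0); first by rewrite size_mkseq szs size_map size_enum_ord.
    rewrite size_mkseq szs => i iT.
    rewrite nth_mkseq ?szs// (nth_map (Ordinal iT)) ?size_enum_ord//.
    by rewrite /predictions pre nth_enum_ord.
  by rewrite zip_map big_map big_enum.
have [bE cE] := foldl_update_bias_corr
  (zip s (past_predictions R (F w) s)) (State Active 0 0).
rewrite /W -/s szs subnn; apply: potential0_le => //.
- exact/active_bounded_run/ltW.
- rewrite bE add0r (sum_zip (fun b p => b%:R - p)).
  exact: CalDist_ge_bias.
- rewrite bE add0r (sum_zip (fun b p => b%:R - p)).
  exact: CalDist_ge_biasN.
- rewrite cE add0r (sum_zip (fun b p => (2^-1 - p) * (b%:R - p))).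
  by apply: CalDist_ge_linear => t; exact: F01.
Qed.

End Adversary.

(* [ge0_le_integral] would need [f] measurable; the constant is a simple
   function below [f], which suffices. *)
Lemma integral_ge_cst d (T : measurableType d) (R : realType)
    (P : probability T R) (f : T -> R) (c : R) : 0 <= c ->
  (forall w, c <= f w) -> (c%:E <= \int[P]_w (f w)%:E)%E.
Proof.
move=> c0 cf; rewrite ge0_integralTE; last first.
  by move=> w; rewrite lee_fin (le_trans c0).
apply: ereal_sup_ubound; exists (cst_nnsfun T (NngNum c0)) => /=.
  by move=> w; rewrite lee_fin.
by have := sintegral_EFin_cst P setT (NngNum c0);
  rewrite patch_setT /= => ->; rewrite probability_setT mule1.
Qed.

Theorem theorem4 (R : realType) :
  exists (c : R) (T0 : nat), 0 < c /\
  forall T : nat, (T0 <= T)%N ->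
  exists adv : seq bool -> seq R -> R,
    (forall xs ps, 0 <= adv xs ps <= 1) /\
    forall (d : measure_display) (Omega : measurableType d)
           (P : probability Omega R) (F : Omega -> seq bool -> R),
      (forall w xs, 0 <= F w xs <= 1) ->
      (forall xs, measurable_fun setT (fun w => F w xs)) ->
      ((c * (T%:R `^ 3^-1))%:E <=
        \int[P]_w (cond_exp_caldist T adv F w)%:E)%E.
Proof.
(* The initial potential is D/256 - 1/32 for D = T^(1/3), which is at least D/512 exactly when D >=
   16. *)
exists (512^-1), (16 ^ 3)%N; split=> [|T T0T]; first by rewrite invr_gt0.
pose D : R := T%:R `^ 3^-1.
have D3 : D ^+ 3 = T%:R.
  by rewrite -powR_mulrn ?powR_ge0// /D -powRrM mulVf// powRr1.
have D16 : 16 <= D.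
  rewrite -(@ler_pXn2r _ 3) ?nnegrE ?powR_ge0// D3 -natrX ler_nat.
  exact: T0T.
exists (adversary R D); split=> [xs ps|d Omega P F F01 _]; first exact: adversary_01.
apply: integral_ge_cst => [|w]; first by rewrite mulr_ge0// powR_ge0.
have TD : T%:R <= D ^+ 3 by rewrite D3.
apply: le_trans (cond_exp_caldist_ge R D T Omega F w D16 (F01 w) TD).
have D0 : D != 0 by rewrite gt_eqF//; lra.
rewrite /= /active_potential -/D -D3 !mul0r expr0n /= exprS mulfK ?expf_neq0//.
by lra.
Qed.
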